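(* Let $q_\nu(u)=I_{\nu+1}(u)/I_\nu(u)$ for $\nu\ge0$, $u>0$. The bound $$q_\nu(u)^2+\frac{(2\nu+1)\,q_\nu(u)}{u}+\frac{\nu+\frac12}{u^2}>1$$ does not hold for every $\nu\ge0$ and $u>0$. At $(\nu,u)=(0,10)$, $$q_0(10)^2+\frac{q_0(10)}{10}+\frac{1}{200}\le1-\frac{9831}{10^8}<1.$$
   Context: $I_\nu$ is the modified Bessel function of the first kind of order $\nu$: for $u>0$, $I_\nu(u)=\sum_{k\ge0}\frac{(u/2)^{2k+\nu}}{k!\,\Gamma(k+\nu+1)}$. *)

(* Defs.v *)
From Stdlib Require Import Reals Factorial.
From Coquelicot Require Import Coquelicot.
Open Scope R_scope.

(* Euler's integral of the second kind, improper at both ends; meaningful for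
   [x > 0], the only range that occurs in [besselI nu] with [nu >= 0]. *)
Definition Gamma (x : R) : R :=
  RInt_gen (fun t => Rpower t (x - 1) * exp (- t))
    (at_right 0) (Rbar_locally p_infty).

(* Meaningful for [u > 0], where [Rpower (u / 2)] is the real power. *)
Definition besselI (nu u : R) : R :=
  Series (fun k : nat =>
    Rpower (u / 2) (2 * INR k + nu) / (INR (fact k) * Gamma (INR k + nu + 1))).

Definition bessel_ratio (nu u : R) : R := besselI (nu + 1) u / besselI nu u.

(* Main.v *)
Require Import Defs.
From Stdlib Require Import Reals.
From Stdlib Require Import Factorial Lra Lia.
From Coquelicot Require Import Coquelicot.
Open Scope R_scope.

(** Both claims follow from the single estimate [q_0(10) <= 9487/10000]: the
    polynomial [q^2 + q/10 + 1/200] is increasing for [q >= 0], and its value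
    at [q = 9487/10000] is [0.99990169], which is exactly [1 - 9831/10^8].

    Writing [c = 9487/10000], the estimate says [c I_0(10) - I_1(10) >= 0].
    Combining the two power series termwise,
    [c I_0(10) - I_1(10) = sum_k 25^k / k!^2 * (c - 5 / (k + 1))],
    and the terms are nonnegative as soon as [5 / (k + 1) <= c], that is, from
    [k = 5] on.  Hence every partial sum past that index is a lower bound for
    the whole series, and the one over [k <= 11] is already positive, about
    [0.109] ([besselI_1_le_besselI_0]).

    To expose these power series, the improper Euler integral is evaluated at
    the positive integers, [Gamma (n + 1) = n!] ([Gamma_INR]), by means of an
    explicit primitive of [t^n e^(-t)]. *)

(** * Euler's integral at positive integers *)

(** The recursion is integration by parts; unfolded, this is
    [- e^(-t) n! (1 + t + ... + t^n / n!)], the primitive of [t^n e^(-t)] that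
    vanishes at infinity. *)
Fixpoint Gamma_primitive (n : nat) (t : R) : R :=
  match n with
  | O => - exp (- t)
  | S m => - (t ^ n * exp (- t)) + INR n * Gamma_primitive m t
  end.

Lemma is_derive_Gamma_primitive (n : nat) (t : R) :
  is_derive (Gamma_primitive n) t (t ^ n * exp (- t)).
Proof.
induction n as [|n IH].
- simpl. auto_derive; [easy | ring].
- assert (H : is_derive (fun t => - (t ^ S n * exp (- t))) t
     (- (INR (S n) * t ^ n * exp (- t)) + t ^ S n * exp (- t))).
  { auto_derive; [easy |]. destruct n; simpl; ring. }
  evar_last.
  + apply @is_derive_plus; [exact H | apply is_derive_scal; exact IH].
  + change (@plus R_NormedModule) with Rplus. ring.
Qed.

Lemma Gamma_primitive_0 (n : nat) : Gamma_primitive n 0 = - INR (fact n).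
Proof.
induction n as [|n IH]; cbn [Gamma_primitive].
- rewrite Ropp_0, exp_0. simpl. ring.
- rewrite IH, fact_simpl, mult_INR. simpl pow. ring.
Qed.

(** One term of the exponential series, [t^(n+1) / (n+1)! <= e^t], gives
    [t^n e^(-t) <= (n+1)! / t]. *)
Lemma is_lim_pow_mul_exp_opp (n : nat) :
  is_lim (fun t => t ^ n * exp (- t)) p_infty 0.
Proof.
apply is_lim_le_le_loc with (f := fun _ => 0)
  (g := fun t => INR (fact (S n)) * / t).
- exists 0. intros t Ht. split.
  + apply Rmult_le_pos; [apply pow_le; lra | left; apply exp_pos].
  + assert (Hf := INR_fact_lt_0 (S n)).
    assert (Hterm : t ^ S n / INR (fact (S n)) <= exp t).
    { eapply Rle_trans; [| apply (exp_ge_taylor t (S n)); lra].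
      rewrite tech5.
      assert (0 <= sum_f_R0 (fun k => t ^ k / INR (fact k)) n); [| lra].
      apply cond_pos_sum. intros k. apply Rdiv_le_0_compat.
      - apply pow_le; lra.
      - apply INR_fact_lt_0. }
    assert (He := exp_pos t).
    rewrite exp_Ropp.
    apply Rmult_le_reg_r with (t * exp t / INR (fact (S n))).
    { apply Rdiv_lt_0_compat; [apply Rmult_lt_0_compat |]; lra. }
    replace (t ^ n * / exp t * (t * exp t / INR (fact (S n))))
      with (t ^ S n / INR (fact (S n))) by (simpl pow; field; lra).
    replace (INR (fact (S n)) * / t * (t * exp t / INR (fact (S n))))
      with (exp t) by (field; lra).
    exact Hterm.
- apply is_lim_const.
- evar_last.
  + apply is_lim_scal_l, is_lim_inv; [apply is_lim_id | easy].
  + simpl. f_equal. ring.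
Qed.

Lemma is_lim_Gamma_primitive (n : nat) : is_lim (Gamma_primitive n) p_infty 0.
Proof.
assert (Hopp : forall m,
  is_lim (fun t => - (t ^ m * exp (- t))) p_infty 0).
{ intros m. evar_last; [apply is_lim_opp, is_lim_pow_mul_exp_opp |].
  simpl. f_equal. ring. }
induction n as [|n IH].
- apply is_lim_ext with (2 := Hopp 0%nat). intros t. simpl. ring.
- cbn [Gamma_primitive].
  evar_last.
  + apply is_lim_plus'; [apply Hopp |].
    evar_last; [apply is_lim_scal_l, IH |]. reflexivity.
  + simpl. f_equal. ring.
Qed.

Lemma Gamma_INR (n : nat) : Gamma (INR n + 1) = INR (fact n).
Proof.
unfold Gamma. apply is_RInt_gen_unique.
assert (HD : forall t, Derive (Gamma_primitive n) t = t ^ n * exp (- t)).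
{ intros t. apply is_derive_unique, is_derive_Gamma_primitive. }
apply is_RInt_gen_ext with (f := Derive (Gamma_primitive n)).
- apply Filter_prod with (Q := fun a => 0 < a) (R := fun b => 0 < b).
  + exists (mkposreal 1 Rlt_0_1). intros a _ Ha. exact Ha.
  + exists 0. intros b Hb. exact Hb.
  + intros a b Ha Hb t [Ht _]. simpl in Ht.
    assert (0 < t).
    { apply Rlt_trans with (2 := Ht). now apply Rmin_glb_lt. }
    replace (INR n + 1 - 1) with (INR n) by ring.
    rewrite Rpower_pow by assumption. apply HD.
- replace (INR (fact n)) with (0 - - INR (fact n)) by ring.
  apply is_RInt_gen_Derive.
  + apply filter_forall. intros ab t _. eexists.
    apply is_derive_Gamma_primitive.
  + apply filter_forall. intros ab t _.
    apply continuous_ext with (f := fun t => t ^ n * exp (- t)).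
    { intros s. symmetry. apply HD. }
    apply @ex_derive_continuous. auto_derive. easy.
  + rewrite <- Gamma_primitive_0.
    eapply filterlim_filter_le_1; [apply filter_le_within |].
    apply @ex_derive_continuous. eexists. apply is_derive_Gamma_primitive.
  + exact (is_lim_Gamma_primitive n).
Qed.

(** * Bessel functions of integer order *)

Definition besselI_term (m : nat) (u : R) (k : nat) : R :=
  (u / 2) ^ (2 * k + m) / (INR (fact k) * INR (fact (k + m))).

Lemma besselI_INR (m : nat) (u : R) :
  0 < u -> besselI (INR m) u = Series (besselI_term m u).
Proof.
intros Hu. apply Series_ext. intros k. unfold besselI_term.
replace (2 * INR k + INR m) with (INR (2 * k + m))
  by (rewrite plus_INR, mult_INR; simpl; ring).
rewrite Rpower_pow by lra.
rewrite <- plus_INR, Gamma_INR. reflexivity.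
Qed.

Lemma besselI_term_pos (m : nat) (u : R) (k : nat) :
  0 < u -> 0 < besselI_term m u k.
Proof.
intros Hu. apply Rdiv_lt_0_compat.
- apply pow_lt. lra.
- apply Rmult_lt_0_compat; apply INR_fact_lt_0.
Qed.

(** Dropping the factor [1 / (k + m)! <= 1] leaves a multiple of the
    exponential series at [(u / 2)^2]. *)
Lemma ex_series_besselI (m : nat) (u : R) :
  0 < u -> ex_series (besselI_term m u).
Proof.
intros Hu.
apply @ex_series_le with
  (b := fun k => (u / 2) ^ m * (((u / 2) ^ 2) ^ k * / INR (fact k))).
- intros k. change (norm ?x) with (Rabs x).
  rewrite Rabs_pos_eq by (left; now apply besselI_term_pos).
  unfold besselI_term.
  assert (Hk := INR_fact_lt_0 k). assert (Hkm := INR_fact_lt_0 (k + m)).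
  assert (H1 : 1 <= INR (fact (k + m))).
  { apply (le_INR 1). apply lt_O_fact. }
  rewrite pow_add, <- pow_mult.
  replace ((u / 2) ^ (2 * k) * (u / 2) ^ m
             / (INR (fact k) * INR (fact (k + m))))
    with ((u / 2) ^ m * ((u / 2) ^ (2 * k) * / INR (fact k))
             * / INR (fact (k + m))) by (field; lra).
  rewrite <- Rmult_1_r. apply Rmult_le_compat_l.
  + repeat apply Rmult_le_pos; try (apply pow_le; lra).
    left. now apply Rinv_0_lt_compat.
  + rewrite <- Rinv_1. apply Rinv_le_contravar; lra.
- apply @ex_series_scal_l. exists (exp ((u / 2) ^ 2)).
  eapply is_series_ext; [| exact (is_exp_Reals ((u / 2) ^ 2))].
  intros k. simpl. rewrite pow_n_pow. reflexivity.
Qed.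

Lemma Series_ge_partial_sum (a : nat -> R) (n : nat) :
  ex_series a -> (forall k, (n < k)%nat -> 0 <= a k) ->
  sum_f_R0 a n <= Series a.
Proof.
intros Ha Hpos.
rewrite (Series_incr_n a (S n)) by (lia || assumption). simpl pred.
set (b := fun k => a (S n + k)%nat).
assert (H : 0 * Series b <= Series b); [| lra].
rewrite <- Series_scal_l. apply Series_le.
- intros k. assert (0 <= b k) by (apply Hpos; lia). lra.
- now apply ex_series_incr_n.
Qed.

Lemma besselI_INR_pos (m : nat) (u : R) : 0 < u -> 0 < besselI (INR m) u.
Proof.
intros Hu. rewrite besselI_INR by assumption.
apply Rlt_le_trans with (besselI_term m u 0).
- now apply besselI_term_pos.
- apply (Series_ge_partial_sum (besselI_term m u) 0).
  + now apply ex_series_besselI.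
  + intros k _. left. now apply besselI_term_pos.
Qed.

(** * The estimate at argument 10 *)

(** The common factor [25^k / k!^2] shows the sign of the terms; the cut-off 11
    is the first index at which the partial sum is positive. *)
Lemma besselI_1_le_besselI_0 :
  besselI (INR 1) 10 <= 9487 / 10000 * besselI (INR 0) 10.
Proof.
rewrite !besselI_INR by lra.
assert (H0 : ex_series (besselI_term 0 10)) by (apply ex_series_besselI; lra).
assert (H1 : ex_series (besselI_term 1 10)) by (apply ex_series_besselI; lra).
set (d := fun k => 25 ^ k / INR (fact k) ^ 2 * (9487 / 10000 - 5 / INR (S k))).
assert (Hd : forall k,
  9487 / 10000 * besselI_term 0 10 k - besselI_term 1 10 k = d k).
{ intros k. unfold besselI_term, d.
  replace (10 / 2) with 5 by field.
  rewrite !pow_add, pow_mult, Nat.add_0_r, Nat.add_1_r, fact_simpl, mult_INR.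
  replace (5 ^ 2) with 25 by ring.
  assert (Hk := INR_fact_neq_0 k).
  assert (HS : INR (S k) <> 0) by (apply not_0_INR; lia).
  simpl pow. field. auto. }
assert (H0' : ex_series (fun k => 9487 / 10000 * besselI_term 0 10 k)).
{ now apply @ex_series_scal_l. }
assert (Hlow : sum_f_R0 d 11 <= Series d).
{ apply Series_ge_partial_sum.
  - apply ex_series_ext with (1 := Hd). now apply @ex_series_minus.
  - intros k Hk. unfold d. apply Rmult_le_pos.
    + apply Rdiv_le_0_compat; [apply pow_le; lra |].
      apply pow_lt, INR_fact_lt_0.
    + assert (HS : 13 <= INR (S k)).
      { replace 13 with (INR 13) by (simpl; ring). apply le_INR. lia. }
      assert (5 / INR (S k) <= 5 / 13); [| lra].
      apply Rmult_le_compat_l; [lra |]. apply Rinv_le_contravar; lra. }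
assert (Hsum : 0 <= sum_f_R0 d 11).
{ unfold d. cbn [sum_f_R0].
  (* Factorials are split into real factors, since [fact 11] would be far too
     large to compute in unary. *)
  rewrite !fact_simpl, !mult_INR, !INR_IZR_INZ.
  cbv [fact Z.of_nat Pos.of_succ_nat Pos.succ].
  lra. }
rewrite <- (Series_ext _ _ Hd), Series_minus, Series_scal_l in Hlow
  by assumption.
lra.
Qed.

Lemma bessel_ratio_0_10 : 0 <= bessel_ratio 0 10 <= 9487 / 10000.
Proof.
unfold bessel_ratio. rewrite Rplus_0_l.
change (0 <= besselI (INR 1) 10 / besselI (INR 0) 10 <= 9487 / 10000).
assert (HI0 : 0 < besselI (INR 0) 10) by (apply besselI_INR_pos; lra).
assert (HI1 : 0 < besselI (INR 1) 10) by (apply besselI_INR_pos; lra).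
split.
- apply Rdiv_le_0_compat; [now left | assumption].
- apply Rle_div_l; [assumption |]. exact besselI_1_le_besselI_0.
Qed.

Theorem mainTheorem7 :
  ~ (forall nu u : R, 0 <= nu -> 0 < u ->
       bessel_ratio nu u ^ 2 + (2 * nu + 1) * bessel_ratio nu u / u
         + (nu + 1 / 2) / u ^ 2 > 1)
  /\ bessel_ratio 0 10 ^ 2 + bessel_ratio 0 10 / 10 + 1 / 200
       <= 1 - 9831 / 10 ^ 8
  /\ 1 - 9831 / 10 ^ 8 < 1.
Proof.
assert (Hq : bessel_ratio 0 10 ^ 2 + bessel_ratio 0 10 / 10 + 1 / 200
               <= 1 - 9831 / 10 ^ 8).
{ destruct bessel_ratio_0_10 as [Hpos Hle].
  assert (Hsq := pow_incr _ _ 2 (conj Hpos Hle)).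
  lra. }
split; [| split; [exact Hq | lra]].
intros Hall.
specialize (Hall 0 10 (Rle_refl 0) ltac:(lra)).
lra.
Qed.
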